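(* Let $\mathcal{B}_X$ be an eulerian building set. Then for every composition $\alpha=(a_1,\dots,a_k)$ of $|X|$ and every $i\in\{1,\dots,k\}$, $$\sum_{j=0}^{a_i}(-1)^j\zeta_{(a_1,\dots,a_{i-1},j,a_i-j,a_{i+1},\dots,a_k)}(\mathcal{B}_X)=0,$$ where zero parts of compositions are omitted.
   Context: A building set on a finite set $X$ is a collection $\mathcal{B}$ of nonempty subsets of $X$ such that (B1) if $S,S'\in\mathcal{B}$ and $S\cap S'\neq\emptyset$ then $S\cup S'\in\mathcal{B}$, and (B2) $\{i\}\in\mathcal{B}$ for all $i\in X$. Restriction: $\mathcal{B}|_I=\{S\in\mathcal{B}:S\subset I\}$; discrete means only singletons. For a composition $\beta=(b_1,\dots,b_l)$ of $|X|$, $\zeta_\beta(\mathcal{B}_X)$ is the number of ordered decompositions $X=J_1\sqcup\dots\sqcup J_l$ with $|J_i|=b_i$ and each $\mathcal{B}_X|_{J_i}$ discrete. Let $\zeta^{-1}$ be defined on building sets by $\zeta^{-1}(\mathcal{B}_\emptyset)=1$ and, for $X\ne\emptyset$, $\zeta^{-1}(\mathcal{B}_X)=\sum_{k\ge1}(-1)^kN_k$, where $N_k$ is the number of ordered decompositions $X=J_1\sqcup\dots\sqcup J_k$ into nonempty sets with each $\mathcal{B}_X|_{J_i}$ discrete (this is the convolution inverse of the character ''$\mathcal{B}$ is discrete'' on the Hopf algebra of building sets). A building set $\mathcal{B}_X$ is eulerian if for every $J\subset X$, either $\mathcal{B}_X|_J$ is discrete or $\zeta^{-1}(\mathcal{B}_X|_J)=0$.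 *)

(* Defs.v *)
From mathcomp Require Import all_boot all_order all_algebra.

Set Implicit Arguments.
Unset Strict Implicit.
Unset Printing Implicit Defensive.

Import GRing.Theory.
Local Open Scope ring_scope.

Section BuildingSets.
Variable T : finType.
Implicit Types (X I : {set T}) (B : {set {set T}}).

(* The ground set X is carried separately from B, inside an ambient finite type
   T, so that a restriction of B is again a building set, on a smaller ground
   set, over the same T. *)
Definition building_set X B : Prop :=
  [/\ forall S, S \in B -> S != set0 /\ S \subset X,
      forall S S', S \in B -> S' \in B -> S :&: S' != set0 -> S :|: S' \in B
    & forall x, x \in X -> [set x] \in B].

Definition restrict B I : {set {set T}} := [set S in B | S \subset I].

Definition discrete B : bool := [forall S in B, #|S| == 1%N].

Definition ordered_decomp X l (J : {ffun 'I_l -> {set T}}) : bool :=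
  (\bigcup_(i < l) J i == X) &&
  [forall i, forall j, (i != j) ==> [disjoint J i & J j]].

Definition zeta (beta : seq nat) X B : nat :=
  #|[set J : {ffun 'I_(size beta) -> {set T}} |
      ordered_decomp X J &&
      [forall i, (#|J i| == nth 0%N beta i) && discrete (restrict B (J i))]]|.

Definition num_decomp X B (k : nat) : nat :=
  #|[set J : {ffun 'I_k -> {set T}} |
      ordered_decomp X J &&
      [forall i, (J i != set0) && discrete (restrict B (J i))]]|.

(* The sum over all k >= 1 stops at k = #|X|: see num_decomp_gt. *)
Definition zeta_inv X B : int :=
  if X == set0 then 1
  else \sum_(1 <= k < #|X|.+1) (-1) ^+ k * (num_decomp X B k)%:Z.

Lemma num_decomp_gt X B k : (#|X| < k)%N -> num_decomp X B k = 0%N.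
Proof.
move=> ltXk; apply/eqP; rewrite cards_eq0; apply/eqP/setP => J.
rewrite !inE; apply/negP => /andP[/andP[/eqP unionJ /forallP disJ] /forallP neJ].
have exJ i : exists x, x \in J i by apply/set0Pn; case/andP: (neJ i).
pose f i := xchoose (exJ i).
have fJ i : f i \in J i := xchooseP (exJ i).
have f_inj : injective f.
  move=> i j eq_f; apply/eqP; apply: contraT => ne_ij.
  have /disjointFr/(_ (fJ i)) := implyP (forallP (disJ i) j) ne_ij.
  by rewrite eq_f fJ.
have : (#|f @: [set: 'I_k]| <= #|X|)%N.
  apply: subset_leq_card; apply/subsetP => _ /imsetP[i _ ->].
  by rewrite -unionJ; apply/bigcupP; exists i.
by rewrite card_imset // cardsT card_ord leqNgt ltXk.
Qed.

Definition eulerian X B : Prop :=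
  forall J : {set T}, J \subset X ->
    discrete (restrict B J) \/ zeta_inv J (restrict B J) = 0.

End BuildingSets.

Definition composition (n : nat) (alpha : seq nat) : bool :=
  all (fun a => 0 < a)%N alpha && (sumn alpha == n).

(* Replaces the part a of index i (counted from 0) by the two parts j and
   a - j, then omits zero parts. *)
Definition split_part (alpha : seq nat) (i j : nat) : seq nat :=
  [seq b <- take i alpha ++ [:: j; (nth 0 alpha i - j)%N] ++ drop i.+1 alpha
     | (0 < b)%N].

(* Main.v *)
Require Import Defs.
From mathcomp Require Import all_boot all_order all_algebra.

(** Write [d] for the indicator of discreteness and [*] for the convolution
    [(f * g)(X) = sum of f K * g (X \ K) over K included in X]. Then [zeta] of
    [b :: beta] is the convolution of [d], cut down to sets of size [b], with
    [zeta] of [beta], and [zeta_inv] is the convolution inverse of [d].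
    On a discrete set that inverse takes the value [(-1) ^ #|X|], because all
    subsets are discrete too; on the other sets it vanishes by eulerianity. So it
    is the signed indicator [(-1) ^ #|X| * d X], whose convolution with [d]
    therefore vanishes on nonempty sets. By associativity this convolution is the
    factor which the alternating sum puts at position [i]. *)

Set Implicit Arguments.
Unset Strict Implicit.
Unset Printing Implicit Defensive.

Import GRing.Theory.
Local Open Scope ring_scope.

(** * Convolution of functions on finite sets *)

Section Convolution.
Variables (T : finType) (R : comNzRingType).
Implicit Types (f g h : {set T} -> R) (X K : {set T}).

Definition conv f g X : R := \sum_(K : {set T} | K \subset X) f K * g (X :\: K).

Lemma eq_conv f f' g g' X :
    (forall K, K \subset X -> f K = f' K) ->
    (forall K, K \subset X -> g K = g' K) ->
  conv f g X = conv f' g' X.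
Proof.
by move=> eq_f eq_g; apply: eq_bigr => K sKX; rewrite eq_f ?eq_g ?subsetDl.
Qed.

Lemma convC f g X : conv f g X = conv g f X.
Proof.
rewrite /conv (reindex_onto (fun K => X :\: K) (fun K => X :\: K)) /=; last first.
  by move=> K sKX; rewrite setDDr setDv set0U; apply/setIidPr.
apply: eq_big => [K|K /andP[_ /eqP ->]]; last exact: mulrC.
by rewrite subsetDl setDDr setDv set0U (sameP eqP setIidPr).
Qed.

(** Both sides run over the splittings of [X] into three ordered blocks [K], [L] and the rest; the
    outer index on the right is [I = K :|: L]. *)
Lemma convA f g h X : conv f (conv g h) X = conv (conv f g) h X.
Proof.
rewrite /conv.
under [RHS]eq_bigr => I _ do rewrite mulr_suml.
rewrite (exchange_big_dep (fun K : {set T} => K \subset X)) /=; last first.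
  by move=> I K sIX sKI; apply: subset_trans sIX.
apply: eq_bigr => K sKX; rewrite mulr_sumr.
rewrite [RHS](reindex_onto (fun L => K :|: L) (fun I => I :\: K)) /=; last first.
  move=> I /andP[_ sKI]; by rewrite -{1}(setIidPr sKI) setID.
apply: eq_big => [L|L].
  rewrite subUset sKX subsetUl andbT /= setDUl setDv set0U subsetD.
  by congr (_ && _); apply/setDidPl/eqP.
rewrite subsetD => /andP[_ dLK].
rewrite mulrA setDDl; congr (_ * g _ * _).
by rewrite setDUl setDv set0U; apply/esym/setDidPl.
Qed.

Lemma conv_suml (I : Type) (r : seq I) (F : I -> {set T} -> R) g X :
  \sum_(i <- r) conv (F i) g X = conv (fun K => \sum_(i <- r) F i K) g X.
Proof.
by rewrite exchange_big; apply: eq_bigr => K _; rewrite mulr_suml.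
Qed.

Lemma conv_sumr (I : Type) (r : seq I) f (G : I -> {set T} -> R) X :
  \sum_(i <- r) conv f (G i) X = conv f (fun K => \sum_(i <- r) G i K) X.
Proof.
by rewrite convC -conv_suml; apply: eq_bigr => i _; apply: convC.
Qed.

Lemma convZl (a : R) f g X : a * conv f g X = conv (fun K => a * f K) g X.
Proof. by rewrite mulr_sumr; apply: eq_bigr => K _; rewrite mulrA. Qed.

Lemma convZr (a : R) f g X : a * conv f g X = conv f (fun K => a * g K) X.
Proof. by rewrite convC convZl convC. Qed.

Lemma conv0l f g X : (forall K, K \subset X -> f K = 0) -> conv f g X = 0.
Proof. by move=> f0; apply: big1 => K sKX; rewrite f0 ?mul0r. Qed.

Lemma conv0r f g X : (forall K, K \subset X -> g K = 0) -> conv f g X = 0.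
Proof. by rewrite convC; apply: conv0l. Qed.

(** Toggling a fixed [x] of [X] pairs the subsets with opposite signs. Hence the sign is the
    convolution inverse of the constant function 1. *)
Lemma sum_subset_sign X :
  \sum_(K : {set T} | K \subset X) (-1) ^+ #|K| = (X == set0)%:R :> R.
Proof.
have [->|[x Xx]] := set_0Vmem X.
  rewrite eqxx (big_pred1 set0) => [|K]; last by rewrite subset0.
  by rewrite cards0.
have -> : (X == set0) = false by apply/negbTE/set0Pn; exists x.
rewrite (bigID (fun K : {set T} => x \in K)) /=.
rewrite (reindex_onto (fun K => x |: K) (fun K => K :\ x)) /=; last first.
  by move=> K /andP[_ xK]; rewrite setD1K.
rewrite (eq_bigl (fun K : {set T} => (K \subset X) && (x \notin K))); last first.
  move=> K; rewrite subUset sub1set Xx setU11 andbT /=; congr (_ && _).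
  apply/eqP/idP => [<-|xK]; first by rewrite !inE eqxx.
  exact: setU1K.
rewrite -big_split big1 //= => K /andP[_ xK].
by rewrite cardsU1 xK exprS mulN1r addNr.
Qed.

(** For a fixed [K] only [j = #|K|] contributes, and then the size condition on [X :\: K] amounts to
    [#|X| = a]. *)
Lemma sum_sign_conv a f g X :
  \sum_(0 <= j < a.+1) (-1) ^+ j *
      conv (fun K => (#|K| == j)%:R * f K)
           (fun K => (#|K| == a - j)%N%:R * g K) X
    = (#|X| == a)%:R * conv (fun K => (-1) ^+ #|K| * f K) g X.
Proof.
rewrite !mulr_sumr.
under eq_bigr => j _ do rewrite mulr_sumr.
rewrite exchange_big; apply: eq_bigr => K sKX /=.
have leKX := subset_leq_card sKX.
have cardD : #|X :\: K| = (#|X| - #|K|)%N by rewrite cardsD (setIidPr sKX).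
have [cardX | neXa] := eqVneq #|X| a; last first.
  rewrite mul0r big_nat big1 // => j /andP[_ ltja].
  case: eqP => [eqKj|_]; last by rewrite !mul0r mulr0.
  (* Both truncated subtractions are exact, since [j] is at most [#|X|] and at most [a]; so equality
     would force [#|X| = a]. *)
  have -> : (#|X :\: K| == a - j)%N = false.
    rewrite eqKj in leKX; rewrite cardD eqKj -(eqn_add2r j).
    by rewrite !subnK // (negbTE neXa).
  by rewrite mul0r !mulr0.
rewrite (bigD1_seq #|K|) ?iota_uniq //=; last first.
  by rewrite mem_index_iota -cardX ltnS leKX.
rewrite cardD cardX !eqxx !mul1r mulrA big1 ?addr0 // => j neKj.
by rewrite eq_sym (negbTE neKj) !mul0r mulr0.
Qed.

End Convolution.

(** * Counting ordered decompositions by iterated convolution *)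

Section Decompositions.
Variable T : finType.
Implicit Types (X K : {set T}).

(** Common form of [zeta] and [num_decomp], which are instances of it up to conversion. The
    condition depends on the position because [zeta] prescribes a size for each block. *)
Definition num_decomp_with l (P : 'I_l -> pred {set T}) X : nat :=
  #|[set J : {ffun 'I_l -> {set T}} |
      ordered_decomp X J && [forall i, P i (J i)]]|.

Lemma num_decomp_with0 (P : 'I_0 -> pred {set T}) X :
  num_decomp_with P X = (X == set0).
Proof.
rewrite /num_decomp_with; have [-> | nzX] := eqVneq X set0.
  apply/eqP/cards1P; exists [ffun => set0]; apply/setP => J; rewrite !inE.
  rewrite /ordered_decomp big_ord0 eqxx /=.
  have -> : J = [ffun => set0] by apply/ffunP => -[].
  by rewrite eqxx; apply/andP; split; apply/forallP => -[].
apply/eqP; rewrite cards_eq0; apply/eqP/setP => J; rewrite !inE.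
by rewrite /ordered_decomp big_ord0 eq_sym (negbTE nzX).
Qed.

Definition fcons l K (J : {ffun 'I_l -> {set T}}) : {ffun 'I_l.+1 -> {set T}} :=
  [ffun i => oapp J K (unlift ord0 i)].

Lemma fcons0 l K (J : {ffun 'I_l -> {set T}}) : fcons K J ord0 = K.
Proof. by rewrite ffunE unlift_none. Qed.

Lemma fconsS l K (J : {ffun 'I_l -> {set T}}) i : fcons K J (lift ord0 i) = J i.
Proof. by rewrite ffunE liftK. Qed.

Lemma ordered_decomp_fcons l X K (J : {ffun 'I_l -> {set T}}) :
  ordered_decomp X (fcons K J) = (K \subset X) && ordered_decomp (X :\: K) J.
Proof.
rewrite /ordered_decomp big_ord_recl fcons0.
under eq_bigr => i _ do rewrite fconsS.
apply/andP/and3P => [[/eqP <- /forallP disJ]|[sKX /eqP unionJ /forallP disJ]].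
  have disK i : [disjoint K & J i].
    have /forallP/(_ (lift ord0 i)) := disJ ord0.
    by rewrite fcons0 fconsS neq_lift.
  split; first exact: subsetUl.
    rewrite setDUl setDv set0U; apply/eqP/esym/setDidPl.
    by rewrite disjoint_sym; apply/bigcup_disjointP => i _.
  apply/forallP => i; apply/forallP => j.
  have /forallP/(_ (lift ord0 j)) := disJ (lift ord0 i).
  by rewrite !fconsS (inj_eq lift_inj).
have disK i : [disjoint K & J i].
  have : J i \subset X :\: K by rewrite -unionJ; apply: bigcup_sup.
  by rewrite subsetD disjoint_sym => /andP[].
split.
  by rewrite unionJ -{1}(setIidPr sKX) setID.
apply/forallP => i; apply/forallP => j; apply/implyP.
case: (unliftP ord0 i) => [i'|] ->; case: (unliftP ord0 j) => [j'|] ->.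
- by rewrite !fconsS (inj_eq lift_inj); apply/implyP/(forallP (disJ i')).
- by rewrite fcons0 fconsS disjoint_sym.
- by rewrite fcons0 fconsS.
- by rewrite eqxx.
Qed.

(** Sort the decompositions by their first block [K]: the other blocks form an arbitrary
    decomposition of [X :\: K] subject to the shifted conditions. *)
Lemma num_decomp_withS l (P : 'I_l.+1 -> pred {set T}) X :
  (num_decomp_with P X)%:R =
    conv (fun K => (P ord0 K)%:R : int)
         (fun K => (num_decomp_with (fun i => P (lift ord0 i)) K)%:R) X.
Proof.
rewrite /num_decomp_with -sum1_card.
rewrite (partition_big (fun J : {ffun 'I_l.+1 -> {set T}} => J ord0) predT) //=.
rewrite natr_sum /conv [RHS]big_mkcond /=; apply: eq_bigr => K _.
rewrite (reindex_onto (fcons K) (fun J => [ffun i => J (lift ord0 i)])) /=; last first.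
  move=> J /andP[_ /eqP <-]; apply/ffunP => i.
  by case: (unliftP ord0 i) => [j|] ->; rewrite ?fconsS ?fcons0 ?ffunE.
rewrite (eq_bigl (fun J => (K \subset X) && P ord0 K &&
   (J \in [set J : {ffun 'I_l -> {set T}} | ordered_decomp (X :\: K) J &&
       [forall i, P (lift ord0 i) (J i)]]))); last first.
  move=> J; rewrite !inE ordered_decomp_fcons fcons0 eqxx andbT.
  have -> : [ffun i => fcons K J (lift ord0 i)] = J.
    by apply/ffunP => i; rewrite ffunE fconsS.
  have -> : [forall i, P i (fcons K J i)] =
      P ord0 K && [forall i, P (lift ord0 i) (J i)].
    apply/forallP/andP => [PJ|[PK /forallP PJ] i].
      split; first by have := PJ ord0; rewrite fcons0.
      by apply/forallP => i; have := PJ (lift ord0 i); rewrite fconsS.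
    by case: (unliftP ord0 i) => [j|] ->; rewrite ?fconsS ?fcons0.
  by rewrite eqxx andbT andbACA.
case: ifP => [sKX|_]; last by rewrite big_pred0.
case: (P ord0 K); last by rewrite mul0r big_pred0.
by rewrite mul1r /= sum1_card.
Qed.

End Decompositions.

(** * Discreteness, its convolution inverse and eulerianity *)

Section Eulerian.
Variables (T : finType) (X : {set T}) (B : {set {set T}}).
Hypotheses (bldB : building_set X B) (eulB : eulerian X B).
Implicit Types (Y K : {set T}) (beta : seq nat).

Definition disc K : int := (discrete (restrict B K))%:R.

Lemma discrete_restrictS K Y :
  K \subset Y -> discrete (restrict B Y) -> discrete (restrict B K).
Proof.
move=> sKY /forallP dY; apply/forallP => S; apply/implyP; rewrite inE.
case/andP=> BS sSK; apply: (implyP (dY S)).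
by rewrite inE BS (subset_trans sSK).
Qed.

Lemma disc0 : disc set0 = 1.
Proof.
rewrite /disc; have -> // : discrete (restrict B set0).
apply/forallP => S; apply/implyP; rewrite inE subset0 => /andP[BS S0].
by case: bldB => /(_ S BS)[] ; rewrite S0.
Qed.

Lemma zeta_nil Y : (zeta [::] Y B)%:Z = (Y == set0)%:R.
Proof.
by rewrite -natz -(num_decomp_with0 (fun i K =>
  (#|K| == nth 0%N [::] i) && discrete (restrict B K))).
Qed.

Lemma zeta_cons b beta Y :
  (zeta (b :: beta) Y B)%:Z =
    conv (fun K => (#|K| == b)%:R * disc K) (fun K => (zeta beta K B)%:Z) Y.
Proof.
rewrite -natz (num_decomp_withS (fun i K =>
  (#|K| == nth 0%N (b :: beta) i) && discrete (restrict B K))).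
apply: eq_conv => K _; first by rewrite -mulnb natrM.
by rewrite -natz.
Qed.

(** A part 0 forces an empty block, which is discrete, so its convolution factor is the unit. Zero
    parts can thus be kept, and the index [j] needs no boundary cases. *)
Lemma zeta_filter beta Y :
  zeta [seq b <- beta | (0 < b)%N] Y B = zeta beta Y B.
Proof.
apply/eqP; rewrite -eqz_nat; apply/eqP.
elim: beta Y => [|b beta IH] Y //=.
case: (posnP b) => [->|b_gt0]; last first.
  by rewrite !zeta_cons; apply: eq_conv => // K _; apply: IH.
rewrite zeta_cons IH /conv (bigD1 set0) ?sub0set //= cards0 disc0 !mul1r setD0.
rewrite big1 ?addr0 // => K /andP[_ nzK].
by rewrite cards_eq0 (negbTE nzK) !mul0r.
Qed.

Lemma num_decomp0 Y : (num_decomp Y B 0)%:Z = (Y == set0)%:R.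
Proof.
by rewrite -natz -(num_decomp_with0 (fun i K =>
  (K != set0) && discrete (restrict B K))).
Qed.

Lemma num_decompS k Y :
  (num_decomp Y B k.+1)%:Z =
    conv (fun K => (K != set0)%:R * disc K)
         (fun K => (num_decomp K B k)%:Z) Y.
Proof.
rewrite -natz (num_decomp_withS (fun i K =>
  (K != set0) && discrete (restrict B K))).
apply: eq_conv => K _; first by rewrite -mulnb natrM.
by rewrite -natz.
Qed.

(** The term [k = 0] absorbs the separate value at the empty set, and the freedom in [n] gives all
    subsets of a set the same summation range. *)
Lemma zeta_invE n Y : (#|Y| < n)%N ->
  zeta_inv Y B = \sum_(0 <= k < n) (-1) ^+ k * (num_decomp Y B k)%:Z.
Proof.
move=> ltYn; rewrite (big_cat_nat (n := #|Y|.+1)) //=.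
rewrite [X in _ + X]big_nat [X in _ + X]big1 ?addr0; last first.
  by move=> k /andP[ltYk _]; rewrite num_decomp_gt ?mulr0.
rewrite big_nat_recl // num_decomp0 mul1r /zeta_inv.
case: eqP => [->|_]; first by rewrite cards0 big_geq ?addr0.
by rewrite add0r big_add1.
Qed.

(** Geometric series: [disc] is the unit plus [disc_pos], and [zeta_inv] is the alternating sum of
    the convolution powers of [disc_pos], so the product telescopes. *)
Lemma conv_disc_zeta_inv Y :
  conv disc (fun K => zeta_inv K B) Y = (Y == set0)%:R.
Proof.
pose disc_pos K : int := (K != set0)%:R * disc K.
have -> : conv disc (fun K => zeta_inv K B) Y =
    zeta_inv Y B + conv disc_pos (fun K => zeta_inv K B) Y.
  rewrite /conv !(bigD1 (P := fun K => K \subset Y) set0) ?sub0set //=.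
  rewrite disc0 mul1r setD0 /disc_pos eqxx !mul0r add0r; congr (_ + _).
  by apply: eq_bigr => K /andP[_ ->]; rewrite mul1r.
(* One index more than for the subsets [K] below: once [k = 0] is split off, the term [k.+1] here
   cancels the term [k] there. *)
rewrite (@zeta_invE #|Y|.+2) // big_nat_recl // num_decomp0 mul1r -addrA.
rewrite -[RHS]addr0; congr (_ + _).
have -> : conv disc_pos (fun K => zeta_inv K B) Y = conv disc_pos
    (fun K => \sum_(0 <= k < #|Y|.+1) (-1) ^+ k * (num_decomp K B k)%:Z) Y.
  apply: eq_conv => // K sKY.
  by rewrite (@zeta_invE #|Y|.+1) // ltnS subset_leq_card.
rewrite -conv_sumr -big_split big1 //= => k _.
by rewrite num_decompS -convZr exprS mulN1r mulNr addNr.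
Qed.

(** The blocks of a decomposition of [Y] lie in [Y], so restricting to [Y] first changes nothing.
    This brings eulerianity to a fixed [B]. *)
Lemma zeta_inv_restrict Y : zeta_inv Y (restrict B Y) = zeta_inv Y B.
Proof.
rewrite /zeta_inv; case: ifP => // _; apply: eq_bigr => k _; congr (_ * _%:Z).
apply: eq_card => J; rewrite !inE; apply: andb_id2l => /andP[/eqP unionJ _].
apply: eq_forallb => i; congr (_ && discrete _).
have sJY : J i \subset Y by rewrite -unionJ; apply: bigcup_sup.
apply/setP => S; rewrite !inE -andbA; congr (_ && _).
by apply: andb_idl => sSJ; apply: subset_trans sJY.
Qed.

Lemma zeta_inv_eulerian Y :
  Y \subset X -> zeta_inv Y B = (-1) ^+ #|Y| * disc Y.
Proof.
have [n] := ubnP #|Y|; elim: n Y => // n IH Y ltYn sYX.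
have [dY|ndY] := boolP (discrete (restrict B Y)); last first.
  rewrite /disc (negbTE ndY) mulr0.
  by case: (eulB sYX) => [dY|]; [rewrite dY in ndY | rewrite zeta_inv_restrict].
have disc1 K : K \subset Y -> disc K = 1.
  by move=> sKY; rewrite /disc (discrete_restrictS sKY dY).
rewrite disc1 // mulr1.
(* Every subset of [Y] is discrete, so [zeta_inv] and the sign have the same sum over the subsets of
   [Y]. They agree on proper subsets by induction, hence also on [Y]. *)
have := conv_disc_zeta_inv Y; rewrite -[RHS](sum_subset_sign int) convC /conv.
rewrite (bigD1 Y) //= [RHS](bigD1 Y) //= setDv disc0 mulr1.
rewrite (eq_bigr (fun K => (-1) ^+ #|K|)); first exact: addIr.
move=> K /andP[sKY neKY].
have pKY : K \proper Y by rewrite properEneq neKY.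
rewrite IH ?(subset_trans sKY) ?disc1 ?mulr1 ?subsetDl //.
exact: leq_trans (proper_card pKY) _.
Qed.

Lemma conv_signed_disc Y : Y \subset X -> Y != set0 ->
  conv (fun K => (-1) ^+ #|K| * disc K) disc Y = 0.
Proof.
move=> sYX nzY; have := conv_disc_zeta_inv Y; rewrite (negbTE nzY) convC.
apply: etrans.
by apply: eq_conv => // K sKY; rewrite zeta_inv_eulerian ?(subset_trans sKY).
Qed.

(** Associativity joins the first two blocks into their union [I]. The alternating sum over [j] then
    only leaves sets [I] of size [a], nonempty as [a] is positive, where the signed convolution
    vanishes. *)
Lemma alternating_zeta_cons2 a beta Y : Y \subset X -> (0 < a)%N ->
  \sum_(0 <= j < a.+1) (-1) ^+ j * (zeta [:: j, (a - j)%N & beta] Y B)%:Z = 0.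
Proof.
move=> sYX a_gt0.
pose disc_at b K : int := (#|K| == b)%:R * disc K.
rewrite (eq_bigr (fun j => conv (fun I => (-1) ^+ j *
  conv (disc_at j) (disc_at (a - j)%N) I) (fun K => (zeta beta K B)%:Z) Y)).
  rewrite conv_suml; apply: conv0l => I sIY; rewrite sum_sign_conv.
  case: eqP => [cardI|_]; last by rewrite mul0r.
  rewrite conv_signed_disc ?mulr0 ?(subset_trans sIY) //.
  by rewrite -card_gt0 cardI.
move=> j _; rewrite -convZl -convA zeta_cons; congr (_ * _).
by apply: eq_conv => // K _; apply: zeta_cons.
Qed.

(** The parts in [s] are outer convolution factors independent of [j]. Peeling one off leaves the
    same sum on subsets of [Y], so [Y] must vary in the induction. *)
Lemma alternating_zeta_cat2 s a beta Y : Y \subset X -> (0 < a)%N ->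
  \sum_(0 <= j < a.+1)
     (-1) ^+ j * (zeta (s ++ [:: j, (a - j)%N & beta]) Y B)%:Z = 0.
Proof.
move=> sYX a_gt0; elim: s Y sYX => [|b s IH] Y sYX.
  exact: alternating_zeta_cons2.
under eq_bigr => j _ do rewrite cat_cons zeta_cons convZr.
by rewrite conv_sumr; apply: conv0r => K sKY; apply/IH/(subset_trans sKY).
Qed.

End Eulerian.

Theorem theorem6 (T : finType) (X : {set T}) (B : {set {set T}})
    (bldB : building_set X B) (eulB : eulerian X B)
    (alpha : seq nat) (compA : composition #|X| alpha)
    (i : nat) (lti : (i < size alpha)%N) :
  \sum_(0 <= j < (nth 0%N alpha i).+1)
     (-1) ^+ j * (zeta (split_part alpha i j) X B)%:Z = 0 :> int.
Proof.
(* With the zero parts restored, the list is [take i alpha], then [j] and [a - j], then the tail,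
   where [a] is the part at index [i]. *)
under eq_bigr => j _ do rewrite (zeta_filter bldB).
apply: (alternating_zeta_cat2 bldB eulB) => //.
by case/andP: compA => /allP pos_alpha _; apply/pos_alpha/mem_nth.
Qed.
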